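(* Suppose $G$ is a $(p,j)$-jumbled graph of density $p$, where $j > 0$. Then \[ f(G) \geq \frac{\mathrm{disc}^+(G)}{j}. \]
   Context: Graphs are finite and simple. The density of a graph $G$ on $n \geq 2$ vertices is $p = |E(G)|/\binom{n}{2}$. A full subgraph of a graph $G$ of density $p$ is an $m$-vertex subgraph $H$ of $G$ of minimum degree at least $p(m-1)$; $f(G)$ denotes the largest number of vertices in a full subgraph of $G$. For $X \subseteq V(G)$, $e(X)$ is the number of edges of $G$ lying in $X$, and $\delta_p(X) = e(X) - p\binom{|X|}{2}$. For a graph $G$ of density $p$, the positive discrepancy is $\mathrm{disc}^+(G) = \max_{X \subseteq V(G)} \delta_p(X)$. A graph $G$ is $(p,j)$-jumbled if $|\delta_p(X)| \leq j|X|$ for every $X \subseteq V(G)$. *)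

(* Defs.v *)
From HB Require Import structures.
From mathcomp Require Import all_boot all_order all_algebra.

Set Implicit Arguments.
Unset Strict Implicit.
Unset Printing Implicit Defensive.

Import Order.TTheory GRing.Theory Num.Theory.
Local Open Scope ring_scope.

(* Every element of [T] is a vertex; an edge is a two-element subset of [T]. *)
Record sgraph (T : finType) := SGraph {
  edges : {set {set T}};
  edges_card2 : forall A : {set T}, A \in edges -> #|A| = 2%N
}.

Definition density (R : realFieldType) (T : finType) (G : sgraph T) : R :=
  #|edges G|%:R / 'C(#|T|, 2)%:R.

(* Not necessarily induced. *)
Definition is_subgraph (T : finType) (G : sgraph T)
    (S : {set T}) (F : {set {set T}}) : bool :=
  (F \subset edges G) && [forall A in F, A \subset S].

Definition degree (T : finType) (F : {set {set T}}) (v : T) : nat :=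
  #|[set A in F | v \in A]|.

(* Nonemptiness is required because the minimum degree of the graph with no
   vertices is undefined. *)
Definition full_subgraph (R : realFieldType) (T : finType) (G : sgraph T)
    (S : {set T}) (F : {set {set T}}) : bool :=
  [&& is_subgraph G S F, S != set0 &
      [forall v in S, density R G * (#|S|%:R - 1) <= (degree F v)%:R]].

(* A single vertex is always a full subgraph, so for a nonempty vertex type
   this maximum ranges over a nonempty family. *)
Definition max_full (R : realFieldType) (T : finType) (G : sgraph T) : nat :=
  \max_(S : {set T} | [exists F : {set {set T}}, full_subgraph R G S F]) #|S|.

Definition edges_in (T : finType) (G : sgraph T) (X : {set T}) : nat :=
  #|[set A in edges G | A \subset X]|.

Definition delta (R : realFieldType) (T : finType) (G : sgraph T)
    (p : R) (X : {set T}) : R :=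
  (edges_in G X)%:R - p * 'C(#|X|, 2)%:R.

(* The default value of the iterated maximum is the value at [X = set0], so
   this is the maximum over all [X] with nothing added. *)
Definition disc_pos (R : realFieldType) (T : finType) (G : sgraph T) : R :=
  \big[Num.max/delta G (density R G) set0]_(X : {set T})
    delta G (density R G) X.

Definition jumbled (R : realFieldType) (T : finType) (G : sgraph T)
    (p j : R) : Prop :=
  forall X : {set T}, `|delta G p X| <= j * #|X|%:R.

(* Main.v *)
(** A set [X] maximising [delta] induces a full subgraph: deleting a vertex [v]
    changes [delta] by [p (#|X| - 1)] minus the degree of [v] in [X], and by
    maximality this change is not positive.  Jumbledness gives
    [delta X <= j #|X|]. *)

Require Import Defs.
From HB Require Import structures.
From mathcomp Require Import all_boot all_order all_algebra.

Set Implicit Arguments.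
Unset Strict Implicit.
Unset Printing Implicit Defensive.

Import Order.TTheory GRing.Theory Num.Theory.
Local Open Scope ring_scope.

Definition induced_edges (T : finType) (G : sgraph T) (X : {set T}) :
    {set {set T}} := [set A in edges G | A \subset X].

Lemma induced_is_subgraph (T : finType) (G : sgraph T) (X : {set T}) :
  is_subgraph G X (induced_edges G X).
Proof.
apply/andP; split; first by apply/subsetP => A; rewrite inE => /andP[].
by apply/forall_inP => A; rewrite inE => /andP[].
Qed.

(** Edges inside [X] split according to whether they contain [v]; those avoiding [v] are exactly the
    edges inside [X :\ v]. *)
Lemma edges_in_setD1 (T : finType) (G : sgraph T) (X : {set T}) (v : T) :
  edges_in G X = (degree (induced_edges G X) v + edges_in G (X :\ v))%N.
Proof.
rewrite /edges_in -(cardsID [set A : {set T} | v \in A]); congr (_ + _)%N.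
  by apply: eq_card => A; rewrite !inE.
by apply: eq_card => A; rewrite !inE subsetD1 andbC -andbA.
Qed.

Lemma delta_setD1 (R : realFieldType) (T : finType) (G : sgraph T) (p : R)
    (X : {set T}) (v : T) : v \in X ->
  delta G p X = delta G p (X :\ v)
    + ((degree (induced_edges G X) v)%:R - p * (#|X|%:R - 1)).
Proof.
move=> vX; rewrite /delta (edges_in_setD1 _ _ v) (cardsD1 v X) vX add1n.
(* With [k] the size of [X :\ v], Pascal's rule gives ['C(k.+1, 2) = 'C(k, 2) + k], and this extra
   [k] is the [#|X|%:R - 1] of the statement. *)
rewrite binS bin1 !natrD -natr1 addrK mulrDr.
by rewrite opprD [RHS]addrACA [X in X + _ = _]addrC.
Qed.

Lemma maximizer_full (R : realFieldType) (T : finType) (G : sgraph T)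
    (X : {set T}) : X != set0 ->
  (forall Y : {set T}, delta G (density R G) Y <= delta G (density R G) X) ->
  full_subgraph R G X (induced_edges G X).
Proof.
move=> X0 maxX; rewrite /full_subgraph induced_is_subgraph X0 /=.
apply/forall_inP => v vX.
by have := maxX (X :\ v); rewrite (delta_setD1 _ _ vX) lerDl subr_ge0.
Qed.

Theorem theorem3 (R : realFieldType) (T : finType) (G : sgraph T) (p j : R)
    (hn : (2 <= #|T|)%N) (hp : density R G = p) (hj : 0 < j)
    (hG : jumbled G p j) :
  disc_pos R G / j <= (max_full R G)%:R.
Proof.
have [X _ maxX] := @arg_maxP _ _ _ set0 xpredT (delta G (density R G)) isT.
have le_disc : disc_pos R G <= delta G (density R G) X.
  (* The default value of the iterated maximum is [delta] at [set0], so maximality of [X] bounds it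
     as well. *)
  by apply: bigmax_le => [|Y _]; apply: maxX.
rewrite ler_pdivrMr // mulrC; apply: (le_trans le_disc).
rewrite hp; apply: le_trans (ler_norm _) (le_trans (hG X) _).
rewrite ler_pM2l // ler_nat.
(* What remains is that [#|X|] is at most [max_full R G]. The maximiser may be empty, and then it is
   not a full subgraph, but its size is 0 and the bound is trivial. *)
have [->|X0] := eqVneq X set0; first by rewrite cards0.
apply: (@leq_bigmax_cond _ _ (fun S : {set T} => #|S|)).
apply/existsP; exists (induced_edges G X).
by apply: maximizer_full => // Y; apply: maxX.
Qed.
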